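(* Let $\mathcal{G}$ be a compact group acting continuously on a sample space $\mathcal{Y}$, let $\mathbb{Q}$ be a probability measure on $\mathcal{Y}$ with group average $\overline{\mathbb{Q}}$, and let $\mathbb{Q} = \mathbb{Q}_a + \mathbb{Q}_s$ be the Lebesgue decomposition of $\mathbb{Q}$ with respect to $\overline{\mathbb{Q}}$. Let $U : [0,\infty] \to [-\infty,\infty]$ be non-decreasing with $U(\infty) = \limsup_{x\to\infty} U(x)$. Let $\varepsilon^U : \mathcal{Y} \to [0,\infty]$ be measurable and such that for every orbit $O$: (i) $\varepsilon^U$ is an exact e-value for $\mathrm{Unif}(O)$, i.e. $\mathbb{E}^{\mathrm{Unif}(O)}[\varepsilon^U] = 1$; (ii) for some $\lambda_O \geq 0$, $$\varepsilon^U(y) \in \operatorname*{argmax}_{x \in [0,\infty]} \frac{d\mathbb{Q}_a}{d\overline{\mathbb{Q}}}(y)\, U(x) - \lambda_O x, \quad \mathrm{Unif}(O)\text{-a.s.};$$ and $\varepsilon^U = \infty$, $\mathbb{Q}_s$-a.s. Then $\varepsilon^U$ is an exact e-value for $\mathcal{G}$ invariance and is $U$-optimal against $\mathbb{Q}$.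
   Context: All spaces are second-countable locally compact Hausdorff, equipped with their Borel $\sigma$-algebras. $\overline{G}$ follows the Haar probability measure on $\mathcal{G}$. The orbit of $y$ is $O_y = \{Gy : G \in \mathcal{G}\}$; $\mathrm{Unif}(O)$ is the law of $\overline{G}y$ for any $y \in O$. The group average of $\mathbb{Q}$ is $\overline{\mathbb{Q}}(A) = \mathbb{E}_{\overline{G}}[\mathbb{Q}(\overline{G}^{-1}A)]$. A probability $\mathbb{P}$ is $\mathcal{G}$ invariant if $\mathbb{P}(G^{-1}A) = \mathbb{P}(A)$ for all $G, A$. A measurable $\varepsilon : \mathcal{Y} \to [0,\infty]$ is valid (exact) for $\mathcal{G}$ invariance if $\mathbb{E}^{\mathbb{P}}[\varepsilon] \leq 1$ ($=1$) for every $\mathcal{G}$ invariant probability $\mathbb{P}$. The objective in (ii) at $x = \infty$ is understood as its limsup as $x \to \infty$, and $0 \cdot (\pm\infty) = 0$. An e-value $\varepsilon^*$ that is valid for $\mathcal{G}$ invariance, with $\varepsilon^* = \infty$ $\mathbb{Q}_s$-a.s., is $U$-optimal against $\mathbb{Q}$ if $\mathbb{E}^{\mathbb{Q}_a}[U(\varepsilon^* )] \geq \mathbb{E}^{\mathbb{Q}_a}[U(\varepsilon)]$ for every e-value $\varepsilon$ valid for $\mathcal{G}$ invariance (with $\varepsilon=\infty$ imposed $\mathbb{Q}_s$-a.s.), whenever both sides are well-defined in $[-\infty,\infty]$; here $\mathbb{E}^{\mathbb{Q}_a}$ denotes integration against the sub-probability $\mathbb{Q}_a$. *)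

(* Defs.v *)
(* [measurable_realfun] provides the Borel sigma-algebra of \bar R; it is not
   re-exported by [all_analysis]. *)
From HB Require Import structures.
From mathcomp Require Import all_boot all_order all_algebra.
From mathcomp Require Import all_classical all_reals all_analysis measurable_realfun.

Set Implicit Arguments.
Unset Strict Implicit.
Unset Printing Implicit Defensive.

Import Order.TTheory GRing.Theory Num.Theory.
Import numFieldNormedType.Exports.

Local Open Scope classical_set_scope.
Local Open Scope ring_scope.
Local Open Scope ereal_scope.
Local Open Scope charge_scope.

(* Pointedness is required by the library's measurable types; it costs nothing
   since a group, or a space carrying a probability measure, is inhabited. *)
HB.mixin Record isTopGroup G & Group G & PointedTopological G := {
  mulg_continuous : continuous (fun gh : G * G => (gh.1 * gh.2)%g);
  invg_continuous : continuous (fun g : G => (g^-1)%g);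
}.

#[short(type="topGroupType")]
HB.structure Definition TopGroup :=
  {G of Group G & PointedTopological G & isTopGroup G}.

Definition lcsch_space (T : topologicalType) :=
  [/\ @second_countable T, locally_compact [set: T] & hausdorff_space T].

Notation borel T := (g_sigma_algebraType (@open T)).

Section group_invariance.
Context {R : realType} {G : topGroupType} {Y : ptopologicalType}.
Implicit Types (haar : probability (borel G) R) (act : G -> Y -> Y).
Implicit Types (eps : borel Y -> \bar R).

Definition continuous_action act :=
  [/\ forall y, act 1%g y = y,
      forall g h y, act (g * h)%g y = act g (act h y) &
      continuous (fun gy : G * Y => act gy.1 gy.2)].

Definition is_haar haar := forall (g : G) (A : set (borel G)),
  measurable A -> haar [set (g * h)%g | h in A] = haar A.

Definition act_orbit act (y : Y) : set Y := [set act g y | g in [set: G]].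

Definition is_orbit act (O : set Y) := exists y, O = act_orbit act y.

(* The law of [act g y] for [g] Haar distributed does not depend on the point
   [y] of [O], because a left-invariant probability measure on a compact group
   is also right-invariant; [xget] selects one such point. *)
Definition unif_orbit haar act (O : set Y) : set (borel Y) -> \bar R :=
  pushforward haar (fun g : borel G => act g (xget point O) : borel Y).

Definition is_group_average haar act (Q Qbar : probability (borel Y) R) :=
  forall A : set (borel Y), measurable A ->
    Qbar A = \int[haar]_g Q [set act (g^-1)%g y | y in A].

Definition G_invariant act (P : probability (borel Y) R) :=
  forall (g : G) (A : set (borel Y)), measurable A ->
    P [set act (g^-1)%g y | y in A] = P A.

Definition evalue eps := measurable_fun [set: borel Y] eps /\
  forall y, 0 <= eps y.

Definition valid_evalue act eps := evalue eps /\
  forall P : probability (borel Y) R, G_invariant act P ->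
    \int[P]_y eps y <= 1.

Definition exact_evalue act eps := evalue eps /\
  forall P : probability (borel Y) R, G_invariant act P ->
    \int[P]_y eps y = 1.

(* The integral of [f], that is \int f^+ - \int f^-, is not of the form
   +oo - +oo; the library's [integral] is total and returns -oo in that case. *)
Definition integral_defined (mu : set (borel Y) -> \bar R)
    (f : borel Y -> \bar R) : bool :=
  (\int[mu]_y f^\+ y) +? (- \int[mu]_y f^\- y).

Definition U_optimal act (Qa Qs : {measure set (borel Y) -> \bar R})
    (U : \bar R -> \bar R) (epsU : borel Y -> \bar R) :=
  [/\ valid_evalue act epsU,
      {ae Qs, forall y, epsU y = +oo} &
      forall eps, valid_evalue act eps -> {ae Qs, forall y, eps y = +oo} ->
        integral_defined Qa (U \o epsU) -> integral_defined Qa (U \o eps) ->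
        \int[Qa]_y U (eps y) <= \int[Qa]_y U (epsU y)].

End group_invariance.

Section lebesgue_decomposition.
Context d {T : measurableType d} {R : realType}.

Definition mutually_singular (m1 m2 : {measure set T -> \bar R}) :=
  exists N : set T, [/\ measurable N, m1 N = 0 & m2 (~` N) = 0].

Definition lebesgue_decomposition (nu mu nua nus : {measure set T -> \bar R}) :=
  [/\ forall A, measurable A -> nu A = nua A + nus A,
      nua `<< mu & mutually_singular nus mu].

(* 'd nu '/d mu is one fixed real-valued version of the derivative, whose sign
   is unconstrained on a [mu]-null set; [f] is an arbitrary nonnegative
   version. *)
Definition density_version (nu : {finite_measure set T -> \bar R})
    (mu : {sigma_finite_measure set T -> \bar R}) (f : T -> \bar R) :=
  [/\ measurable_fun [set: T] f, forall x, 0 <= f x &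
      f = 'd (charge_of_finite_measure nu) '/d mu %[ae mu]].

End lebesgue_decomposition.

Section objective.
Context {R : realType}.
Implicit Types (U : \bar R -> \bar R) (x : \bar R).

(* Functions on [0, +oo] are represented by functions on \bar R, whose values
   at negative arguments are never used. *)
Definition nondecreasing_ge0 U := forall x x', 0 <= x -> x <= x' -> U x <= U x'.

Definition limsup_pinfty (h : \bar R -> \bar R) : \bar R :=
  limf_esup (fun r : R => h r%:E) (pinfty_nbhs R).

(* For finite [x] the term [l * x] is finite, so the difference is never
   +oo - +oo; and 0 * +oo = 0 * -oo = 0 in \bar R. *)
Definition objective (q : \bar R) U (l : R) x : \bar R :=
  if x == +oo then limsup_pinfty (fun x' => q * U x' - l%:E * x')
  else q * U x - l%:E * x.

Definition is_argmax_ge0 (h : \bar R -> \bar R) x :=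
  0 <= x /\ forall x', 0 <= x' -> h x' <= h x.

End objective.

(* Main.v *)
Require Import Defs.
From mathcomp Require Import all_boot all_order all_algebra.
From mathcomp Require Import all_classical all_reals all_analysis measurable_realfun.
From mathcomp Require Import lra.

(** Everything reduces to single orbits, because an invariant probability [P]
is a mixture of the laws [Unif(O)]: by Tonelli and the invariance of [P],
[\int f dP] is the [P]-average over [y] of the integral of [f] against
[Unif(O_y)] ([ge0_integral_act], [integral_unif_orbit]).  Exactness of [epsU]
is the case [f = epsU], where all orbit integrals are 1.

For optimality, write [a = q U(epsU)] and [b = q U(eps)], with [q] the density
of [Qa].  On one orbit, with multiplier [l], the argmax property gives
[b - l eps <= a - l epsU] almost surely.  Both e-values have integral at most 1
under [Unif(O)], so they are almost surely finite there and the objective is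
compared at finite points only.  Integrating the inequality bounds the
integral of [b] by that of [a], since [l] is paid on an integral equal to 1 for
[epsU] and at most 1 for [eps].

Two difficulties shape the details.  The integrals of [a] and [b] may be
infinite or, on single orbits, undefined; so the inequality is first rearranged
as [b^+ + a^- + l epsU <= a^+ + b^- + l eps], in which all terms are nonnegative
([domination_of_argmax]).  The multiplier need not depend measurably on the
orbit; so it is cancelled orbit by orbit ([integral_tradeoff]), which leaves
[\int (b^+ + a^-) <= \int (a^+ + b^-)] on each orbit.  This inequality is
averaged over the orbits with respect to the invariant probability [Qbar]
([group_average_invariant], [integral_le_of_orbitwise]), and the positive and
negative parts are put back in place only for the global integrals, whose
differences are assumed to make sense ([lee_sub_of_add]). *)

Set Implicit Arguments.
Unset Strict Implicit.
Unset Printing Implicit Defensive.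

Import Order.TTheory GRing.Theory Num.Theory.
Import numFieldNormedType.Exports.

Local Open Scope classical_set_scope.
Local Open Scope ring_scope.
Local Open Scope ereal_scope.

(** * Borel measurability *)

Lemma continuous_borel_measurable (T Z : ptopologicalType) (f : T -> Z) :
  continuous f -> measurable_fun [set: borel T] (f : borel T -> borel Z).
Proof.
move=> fc; apply: (@measurability _ _ _ (borel Z) _ _ (@open Z)) => //.
move=> _ [W oW] <-; rewrite setTI.
by apply: sub_sigma_algebra; exact: open_comp.
Qed.

(** Countable bases make every open set of the product a countable union of open
rectangles, so the product of the Borel sigma-algebras is large enough for
Tonelli to apply to [(g, y) |-> f (act g y)]. *)
Lemma continuous2_borel_measurable (T1 T2 Z : ptopologicalType)
    (f : T1 * T2 -> Z) :
  @second_countable T1 -> @second_countable T2 -> continuous f ->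
  measurable_fun [set: borel T1 * borel T2]
    (f : borel T1 * borel T2 -> borel Z).
Proof.
move=> [B1 cB1 [oB1 bB1]] [B2 cB2 [oB2 bB2]] fc.
apply: (@measurability _ _ _ (borel Z) _ _ (@open Z)) => //.
move=> _ [W oW] <-; rewrite setTI.
have oP : open (f @^-1` W) by exact: open_comp.
pose I := [set V : set T1 * set T2 |
  [/\ B1 V.1, B2 V.2 & V.1 `*` V.2 `<=` f @^-1` W]].
have -> : f @^-1` W = \bigcup_(V in I) (V.1 `*` V.2).
  apply/seteqP; split => [[x y] fxy|]; last first.
    by move=> [x y] [[V1 V2] [_ _ /= sub] xy]; exact: sub.
  have : nbhs (x, y) (f @^-1` W) by exact: open_nbhs_nbhs.
  case=> -[N1 N2] [/= /bB1[V1 [B1V V1x] V1N] /bB2[V2 [B2V V2y] V2N]] NO.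
  exists (V1, V2) => //; split => //= -[a b] /= [aV bV].
  by apply: NO; split; [exact: V1N | exact: V2N].
rewrite bigcup_set_type; apply: countable_bigcupT_measurable.
  rewrite (eq_countable (card_setT I)).
  apply: (@sub_countable _ _ _ (B1 `*` B2)); last exact: countableX.
  by apply: subset_card_le => -[V1 V2] [].
move=> [[V1 V2] /= /set_mem[/= /oB1 oV1 /oB2 oV2 _]].
by apply: measurableX; exact: sub_sigma_algebra.
Qed.

(** An up-closed set is the closed or open ray starting at its infimum. *)
Lemma measurable_upset (R : realType) (S : set \bar R) :
  (forall x y, S x -> x <= y -> S y) -> measurable S.
Proof.
move=> Sup.
have geS x : ereal_inf S < x -> S x.
  by move=> /ereal_inf_lt[y Sy /ltW /(Sup _ _ Sy)].
have [Si|nSi] := pselect (S (ereal_inf S)).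
  have -> : S = [set` `[ereal_inf S, +oo[%O].
    apply/seteqP; split => x /=; rewrite in_itv/= andbT.
      exact: ereal_inf_lbound.
    exact: Sup.
  exact: emeasurable_itv.
have -> : S = [set` `]ereal_inf S, +oo[%O].
  apply/seteqP; split => x /=; rewrite in_itv/= andbT; last exact: geS.
  move=> Sx; rewrite lt_neqAle ereal_inf_lbound// andbT.
  by apply/eqP => E; apply: nSi; rewrite E.
exact: emeasurable_itv.
Qed.

(** [U] is unconstrained at negative arguments, so it is replaced by
[x |-> U (maxe 0 x)], which is monotone everywhere and agrees with it on the
values of [f]. *)
Lemma nondecreasing_ge0_measurable_comp d (T : measurableType d)
    (R : realType) (U : \bar R -> \bar R) (f : T -> \bar R) :
  nondecreasing_ge0 U -> measurable_fun [set: T] f -> (forall x, 0 <= f x) ->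
  measurable_fun [set: T] (U \o f).
Proof.
move=> Und mf f0.
have -> : U \o f = (fun x => U (maxe 0 x)) \o f.
  by apply/funext => x /=; rewrite max_r.
apply: measurableT_comp => //.
apply: (measurability (@ErealGenOInfty.G R)).
  exact: ErealGenOInfty.measurableE.
move=> _ [_ [r ->]] <-; rewrite setTI; apply: measurable_upset => x y /=.
rewrite !in_itv/= !andbT => /lt_le_trans + xy; apply.
by apply: Und; [rewrite le_max lexx | exact: le_max2].
Qed.

(** * Invariant probabilities as mixtures of orbit laws *)

Lemma ge0_integral_invariant d (T : measurableType d) (R : realType)
    (mu : {measure set T -> \bar R}) (phi : T -> T) (f : T -> \bar R) :
  measurable_fun [set: T] phi ->
  (forall A, measurable A -> mu (phi @^-1` A) = mu A) ->
  measurable_fun [set: T] f -> (forall x, 0 <= f x) ->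
  \int[mu]_x f (phi x) = \int[mu]_x f x.
Proof.
move=> mphi phimu mf f0.
transitivity (\int[pushforward mu phi]_x f x).
  by rewrite ge0_integral_pushforward.
by apply: (eq_measure_integral mu) => // A mA _; exact: phimu.
Qed.

Lemma probability_integral_cst d (T : measurableType d) (R : realType)
  (P : probability T R) (c : \bar R) : \int[P]_x c = c.
Proof.
have PT : (P : {measure set T -> \bar R}) setT = 1 by exact: probability_setT.
by rewrite (integral_cst P measurableT) PT mule1.
Qed.

Section haar_average.
Context {R : realType} {G : topGroupType}.
Variables (haar : probability (borel G) R).
Hypotheses (G2 : @second_countable G) (haarP : is_haar haar).

Lemma measurable_mulg :
  measurable_fun setT (fun gh : borel G * borel G => (gh.1 * gh.2)%g : borel G).
Proof. exact: (continuous2_borel_measurable G2 G2 mulg_continuous). Qed.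

Lemma measurable_invg : measurable_fun setT (fun g : borel G => (g^-1)%g : borel G).
Proof. exact: (continuous_borel_measurable invg_continuous). Qed.

Lemma measurable_lmulg (h : G) :
  measurable_fun setT (fun g : borel G => (h * g)%g : borel G).
Proof.
exact: (measurableT_comp measurable_mulg (pair1_measurable (h : borel G))).
Qed.

Lemma measurable_rmulg (h : G) :
  measurable_fun setT (fun g : borel G => (g * h)%g : borel G).
Proof.
exact: (measurableT_comp measurable_mulg (pair2_measurable (h : borel G))).
Qed.

Lemma haar_preimage_lmulg (h : G) (A : set (borel G)) : measurable A ->
  haar [set g | A (h * g)%g] = haar A.
Proof.
move=> mA; rewrite -[RHS](haarP (h^-1)%g mA); congr (haar _).
apply/seteqP; split => [g Ahg|_ [k Ak <-]] /=.
  by exists (h * g)%g; rewrite ?mulKg.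
by rewrite mulVKg.
Qed.

Lemma haar_integral_lmulg (h : G) (f : borel G -> \bar R) :
  measurable_fun setT f -> (forall g, 0 <= f g) ->
  \int[haar]_g f (h * g)%g = \int[haar]_g f g.
Proof.
move=> mf f0; apply: (ge0_integral_invariant (measurable_lmulg h)) => // A mA.
exact: haar_preimage_lmulg.
Qed.

(** A left-invariant probability is unimodular: the double integral of
[f (y^-1 * x)] equals the integral of [f] when [x] is integrated first, and that
of [f (y^-1)] when [y] is, since [y^-1 * x = (x^-1 * y)^-1]. *)
Lemma haar_integral_invg (f : borel G -> \bar R) :
  measurable_fun setT f -> (forall g, 0 <= f g) ->
  \int[haar]_g f (g^-1)%g = \int[haar]_g f g.
Proof.
move=> mf f0.
transitivity (\int[haar]_y \int[haar]_x f (y^-1 * x)%g); last first.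
  under eq_integral => y _ do rewrite haar_integral_lmulg//.
  exact: probability_integral_cst.
have mF : measurable_fun setT
    (fun yx : borel G * borel G => f (yx.1^-1 * yx.2)%g).
  apply: (measurableT_comp mf).
  apply: (measurableT_comp
    (g := fun yx : borel G * borel G => (yx.1^-1%g : borel G, yx.2))
    measurable_mulg).
  apply: measurable_fun_pair; last exact: measurable_snd.
  exact: measurableT_comp measurable_invg measurable_fst.
rewrite (fubini_tonelli _ mF)//=.
transitivity (\int[haar]_x \int[haar]_y f (y^-1)%g).
  by rewrite probability_integral_cst.
apply: eq_integral => x _.
rewrite -(haar_integral_lmulg (x^-1)%g (f := fun g => f (g^-1)%g))//; last first.
  exact: measurableT_comp measurable_invg.
by apply: eq_integral => y _; rewrite invgM invgK.
Qed.

(** Right translations are left translations conjugated by inversion. *)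
Lemma haar_integral_rmulg (h : G) (f : borel G -> \bar R) :
  measurable_fun setT f -> (forall g, 0 <= f g) ->
  \int[haar]_g f (g * h)%g = \int[haar]_g f g.
Proof.
move=> mf f0.
rewrite -(haar_integral_invg (f := fun g => f (g * h)%g))//; last first.
  exact: measurableT_comp (measurable_rmulg h).
rewrite -[RHS]haar_integral_invg//.
rewrite -[RHS](haar_integral_lmulg (h^-1)%g (f := fun g => f (g^-1)%g))//.
  by apply: eq_integral => g _; rewrite invgM invgK.
exact: measurableT_comp measurable_invg.
Qed.

Context {Y : ptopologicalType}.
Variable act : G -> Y -> Y.
Hypotheses (Y2 : @second_countable Y) (actP : continuous_action act).

Lemma measurable_act : measurable_fun setT
  (fun gy : borel G * borel Y => act gy.1 gy.2 : borel Y).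
Proof. by case: actP => _ _; exact: continuous2_borel_measurable. Qed.

Lemma measurable_actl (y : Y) :
  measurable_fun setT (fun g : borel G => act g y : borel Y).
Proof.
exact: (measurableT_comp measurable_act (pair2_measurable (y : borel Y))).
Qed.

Lemma measurable_actr (g : G) :
  measurable_fun setT (fun y : borel Y => act g y : borel Y).
Proof.
exact: (measurableT_comp measurable_act (pair1_measurable (g : borel G))).
Qed.

Lemma image_actV (g : G) (A : set Y) :
  [set act (g^-1)%g y | y in A] = [set y | A (act g y)].
Proof.
case: actP => act1 actM _.
apply/seteqP; split => [_ [y Ay <-]|y Agy] /=.
  by rewrite -actM mulgV act1.
by exists (act g y) => //; rewrite -actM mulVg act1.
Qed.

(** The measurability proof is bundled so that the orbit law becomes a
[probability], to which the definition of a valid e-value applies. *)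
Definition unif_orbit_map (O : set Y) : {mfun borel G >-> borel Y} :=
  mfun_Sub (mem_set (measurable_actl (xget point O))).

Definition unif_orbit_probability (O : set Y) : probability (borel Y) R :=
  distribution haar (unif_orbit_map O).

Lemma unif_orbit_probabilityE O :
  unif_orbit haar act O = unif_orbit_probability O.
Proof. by []. Qed.

Lemma unif_orbit_invariant O : G_invariant act (unif_orbit_probability O).
Proof.
case: actP => _ actM _ g A mA; rewrite image_actV.
rewrite -unif_orbit_probabilityE /unif_orbit /pushforward.
rewrite -[RHS](haar_preimage_lmulg g); last first.
  by rewrite -[X in measurable X]setTI; exact: measurable_actl.
by congr (haar _); apply/seteqP; split => k /=; rewrite actM.
Qed.

(** The representative [h y] selected in the orbit is traded for [y] by right
invariance. *)
Lemma integral_unif_orbit (y : Y) (f : borel Y -> \bar R) :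
  measurable_fun setT f -> (forall y, 0 <= f y) ->
  \int[unif_orbit haar act (act_orbit act y)]_z f z =
  \int[haar]_g f (act g y).
Proof.
move=> mf f0; case: (actP) => act1 actM _.
rewrite /unif_orbit ge0_integral_pushforward//; last exact: measurable_actl.
rewrite preimage_setT /=; set x := xget _ _.
have [h _ <-] : act_orbit act y x.
  by apply: xgetPex; exists y, 1%g.
under eq_integral => g _ do rewrite -actM.
apply: (haar_integral_rmulg h (f := fun g => f (act g y))) => //.
exact: measurableT_comp (measurable_actl y).
Qed.

(** For each fixed [g], invariance of [P] makes the inner integral of
[f (act g y)] over [y] independent of [g]; Tonelli then exchanges the order. *)
Lemma ge0_integral_act (P : probability (borel Y) R) (f : borel Y -> \bar R) :
  G_invariant act P -> measurable_fun setT f -> (forall y, 0 <= f y) ->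
  \int[P]_y f y = \int[P]_y \int[haar]_g f (act g y).
Proof.
move=> Pinv mf f0.
have mF : measurable_fun setT
    (fun gy : borel G * borel Y => f (act gy.1 gy.2)).
  exact: measurableT_comp measurable_act.
rewrite -(fubini_tonelli _ mF)//=.
under [RHS]eq_integral => g _.
  rewrite (ge0_integral_invariant (measurable_actr g))//; last first.
    by move=> A mA; rewrite -[RHS](Pinv g A mA) image_actV.
  over.
by rewrite probability_integral_cst.
Qed.

Lemma measurable_haar_average (f : borel Y -> \bar R) :
  measurable_fun setT f -> (forall y, 0 <= f y) ->
  measurable_fun setT (fun y : borel Y => \int[haar]_g f (act g y)).
Proof.
move=> mf f0.
apply: (measurable_fun_fubini_tonelli_G (m1 := haar)
  (fun gy : borel G * borel Y => f (act gy.1 gy.2))) => //.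
exact: measurableT_comp measurable_act.
Qed.

(** Translating a set by [h] translates the integrand of the group average by [h],
which left invariance of the Haar measure absorbs. *)
Lemma group_average_invariant (Q Qbar : probability (borel Y) R) :
  is_group_average haar act Q Qbar -> G_invariant act Qbar.
Proof.
move=> QbarP h A mA; case: (actP) => _ actM _.
have mhA : measurable ([set act (h^-1)%g y | y in A] : set (borel Y)).
  rewrite image_actV -[X in measurable X]setTI; exact: measurable_actr.
rewrite !QbarP//.
rewrite -[RHS](haar_integral_lmulg h
  (f := fun g => Q [set act (g^-1)%g y | y in A]))//; last first.
  pose B := [set gy : borel G * borel Y | A (act gy.1 gy.2)].
  have mB : measurable B by rewrite -[B]setTI; exact: measurable_act.
  apply: eq_measurable_fun (measurable_fun_xsection Q mB) => g _ /=.
  congr (Q _); rewrite image_actV.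
  by apply/seteqP; split => y; rewrite /xsection/= inE.
apply: eq_integral => g _; congr (Q _).
by rewrite !image_actV; apply/seteqP; split => y /=; rewrite actM.
Qed.

Lemma integral_le_of_orbitwise (P : probability (borel Y) R)
    (f g : borel Y -> \bar R) :
  G_invariant act P ->
  measurable_fun setT f -> (forall y, 0 <= f y) ->
  measurable_fun setT g -> (forall y, 0 <= g y) ->
  (forall y, \int[unif_orbit haar act (act_orbit act y)]_z f z <=
             \int[unif_orbit haar act (act_orbit act y)]_z g z) ->
  \int[P]_y f y <= \int[P]_y g y.
Proof.
move=> Pinv mf f0 mg g0 fg.
have -> := ge0_integral_act Pinv mf f0.
have -> := ge0_integral_act Pinv mg g0.
apply: ge0_le_integral => //.
- by move=> y _; exact: integral_ge0.
- exact: measurable_haar_average.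
- exact: measurable_haar_average.
- move=> y _.
  have <- := integral_unif_orbit y mf f0.
  have <- := integral_unif_orbit y mg g0.
  exact: fg.
Qed.

Lemma exact_evalue_of_orbits (eps : borel Y -> \bar R) :
  evalue eps ->
  (forall O : set Y, is_orbit act O -> \int[unif_orbit haar act O]_y eps y = 1) ->
  exact_evalue act eps.
Proof.
move=> [meps eps0] exO; split=> // P Pinv.
have -> := ge0_integral_act Pinv meps eps0.
rewrite -[RHS](probability_integral_cst P); apply: eq_integral => y _.
have <- := integral_unif_orbit y meps eps0.
by apply: exO; exists y.
Qed.

End haar_average.

(** * The pointwise inequality and its integration over one orbit *)

(** Moving every term to the side where it is nonnegative keeps the inequality
meaningful, and true, when [q * u] or [q * v] is infinite: the hypothesis
then excludes [q * u < q * v], and the right-hand side is [+oo]. *)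
Lemma domination_of_argmax (R : realType) (q u v x y : \bar R) (l : R) :
  (0 <= l)%R -> x \is a fin_num -> y \is a fin_num ->
  0 <= x -> 0 <= y ->
  q * v - l%:E * y <= q * u - l%:E * x ->
  (maxe (q * v) 0 + maxe (- (q * u)) 0) + l%:E * x <=
  (maxe (q * u) 0 + maxe (- (q * v)) 0) + l%:E * y.
Proof.
move=> l0; case: x => // x _; case: y => // y _.
rewrite !lee_fin => x0 y0.
have lx0 : (0 <= l * x)%R by rewrite mulr_ge0.
have ly0 : (0 <= l * y)%R by rewrite mulr_ge0.
have maxN (z : R) : (Num.max (- z) 0 = Num.max z 0 - z)%R.
  by case: (@ltP _ R (- z)%R 0%R) => ?; case: (@ltP _ R z 0%R) => ?; lra.
move: (q * u) (q * v) => [a||] [b||] //=;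
  rewrite ?(maxeNy, maxey, maxye, maxNye, oppeK) //=.
- rewrite -!EFinM -?EFinB -?EFin_max -?EFinD !lee_fin => h.
  by rewrite !maxN; lra.
all: by rewrite -?EFin_max /= ?addye ?leey.
Qed.

(** If [a] or [d] is [+oo] then, the differences being defined, [a - b = +oo] or
[c - d = -oo]; otherwise all four terms are finite. *)
Lemma lee_sub_of_add (R : realDomainType) (a b c d : \bar R) :
  0 <= a -> 0 <= b -> 0 <= c -> 0 <= d ->
  a +? - b -> c +? - d -> c + b <= a + d -> c - d <= a - b.
Proof.
move: a b c d => [a||] [b||] [c||] [d||] //=; rewrite ?leey ?leNye //.
by rewrite !lee_fin => *; lra.
Qed.

Lemma ge0_mule_max0 (R : realDomainType) (q u : \bar R) :
  0 <= q -> q * maxe u 0 = maxe (q * u) 0.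
Proof.
move=> q0; case: (leP u 0) => u0.
  by rewrite mule0 max_r// mule_ge0_le0.
by rewrite max_l// mule_ge0// ltW.
Qed.

Lemma integral_density d (T : measurableType d) (R : realType)
    (nu : {finite_measure set T -> \bar R})
    (mu : {sigma_finite_measure set T -> \bar R}) (q f : T -> \bar R) :
  nu `<< mu -> density_version nu mu q ->
  measurable_fun [set: T] f -> (forall x, 0 <= f x) ->
  \int[nu]_x f x = \int[mu]_x (q x * f x).
Proof.
move=> numu [mq q0 qE] mf f0.
rewrite -(Radon_Nikodym_SigmaFinite.change_of_variables numu)//.
have mrn : measurable_fun [set: T] (Radon_Nikodym_SigmaFinite.f nu mu).
  exact: measurable_int (Radon_Nikodym_SigmaFinite.f_integrable numu).
apply: ae_eq_integral => //; [exact: emeasurable_funM..|].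
have rnE := ae_eq_Radon_Nikodym_SigmaFinite numu measurableT.
by apply: filterS2 qE rnE => x qx rnx Tx; rewrite qx// rnx// muleC.
Qed.

(** Adding [l x] on the left and [l y] on the right turns the claim into the
pointwise inequality, and costs [l] on the left and at most [l] on the right;
[l] being finite, it cancels even if the remaining integrals are infinite. *)
Lemma integral_tradeoff d (T : measurableType d) (R : realType)
    (mu : probability T R) (q u v x y : T -> \bar R) (l : R) :
  (0 <= l)%R ->
  measurable_fun setT q -> measurable_fun setT u -> measurable_fun setT v ->
  measurable_fun setT x -> measurable_fun setT y ->
  (forall t, 0 <= x t) -> (forall t, 0 <= y t) ->
  \int[mu]_t x t = 1 -> \int[mu]_t y t <= 1 ->
  {ae mu, forall t, x t \is a fin_num -> y t \is a fin_num ->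
    q t * v t - l%:E * y t <= q t * u t - l%:E * x t} ->
  \int[mu]_t (maxe (q t * v t) 0 + maxe (- (q t * u t)) 0) <=
  \int[mu]_t (maxe (q t * u t) 0 + maxe (- (q t * v t)) 0).
Proof.
move=> l0 mq mu' mv mx my x0 y0 x1 y1 h.
(* A bound on the integral excludes the value +oo almost surely. *)
have ae_fin (z : T -> \bar R) : measurable_fun setT z -> (forall t, 0 <= z t) ->
    \int[mu]_t z t <= 1 -> {ae mu, forall t, z t \is a fin_num}.
  move=> mz z0 z1.
  have iz : mu.-integrable setT z.
    apply/integrableP; split=> //.
    under eq_integral => t _ do rewrite gee0_abs//.
    exact: le_lt_trans z1 (ltry _).
  by have := integrable_ae measurableT iz; apply: filterS => t; apply.
have mM (w z : T -> \bar R) : measurable_fun setT w -> measurable_fun setT z ->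
    measurable_fun setT (fun t => maxe (q t * w t) 0 + maxe (- (q t * z t)) 0).
  move=> mw mz; apply: emeasurable_funD; apply: measurable_maxe => //.
    exact: emeasurable_funM.
  by apply: measurableT_comp => //; exact: emeasurable_funM.
have M0 (w z : T -> \bar R) t : 0 <= maxe (q t * w t) 0 + maxe (- (q t * z t)) 0.
  by rewrite adde_ge0// le_max lexx orbT.
have ml (z : T -> \bar R) : measurable_fun setT z ->
    measurable_fun setT (fun t => l%:E * z t).
  by move=> mz; exact: measurable_funeM.
have l0' (z : T -> \bar R) t : 0 <= z t -> 0 <= l%:E * z t by move=> z0; rewrite mule_ge0.
rewrite -(@leeD2rE _ l%:E)//.
apply: (@le_trans _ _ (\int[mu]_t (maxe (q t * u t) 0 + maxe (- (q t * v t)) 0)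
                       + \int[mu]_t (l%:E * y t))); last first.
  by rewrite leeD2l// ge0_integralZl// -[leRHS]mule1 lee_wpmul2l.
rewrite -{1}[l%:E]mule1 -x1 -ge0_integralZl// -!ge0_integralD//;
  try by [exact: ml | exact: mM | move=> t _; exact: l0'].
apply: ae_ge0_le_integral => //.
- by move=> t _; rewrite adde_ge0// l0'.
- by apply: emeasurable_funD; [exact: mM | exact: ml].
- by move=> t _; rewrite adde_ge0// l0'.
- by apply: emeasurable_funD; [exact: mM | exact: ml].
have finx : {ae mu, forall t, x t \is a fin_num} by apply: ae_fin; rewrite ?x1.
have finy := ae_fin _ my y0 y1.
apply: filterS3 h finx finy => t ht xt yt _.
by apply: domination_of_argmax => //; exact: ht.
Qed.

(** * Exactness and optimality *)

Theorem theorem6 (R : realType) (G : topGroupType) (Y : ptopologicalType)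
  (GS : lcsch_space G) (Gcompact : compact [set: G]) (YS : lcsch_space Y)
  (act : G -> Y -> Y) (act_cont : continuous_action act)
  (haar : probability (borel G) R) (haarP : is_haar haar)
  (Q Qbar : probability (borel Y) R)
  (QbarP : is_group_average haar act Q Qbar)
  (Qa Qs : {finite_measure set (borel Y) -> \bar R})
  (Qdecomp : lebesgue_decomposition Q Qbar Qa Qs)
  (q : borel Y -> \bar R) (qP : density_version Qa Qbar q)
  (U : \bar R -> \bar R) (U_nd : nondecreasing_ge0 U)
  (U_oo : U +oo = limsup_pinfty U)
  (epsU : borel Y -> \bar R) (epsU_meas : measurable_fun [set: borel Y] epsU)
  (epsU_ge0 : forall y, 0 <= epsU y)
  (epsU_exact : forall O : set Y, is_orbit act O ->
    \int[unif_orbit haar act O]_y epsU y = 1)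
  (epsU_argmax : forall O : set Y, is_orbit act O ->
    exists2 lambda : R, (0 <= lambda)%R &
      {ae unif_orbit haar act O,
        forall y, is_argmax_ge0 (objective (q y) U lambda) (epsU y)})
  (epsU_oo : {ae Qs, forall y, epsU y = +oo}) :
  exact_evalue act epsU /\ U_optimal act Qa Qs U epsU.
Proof.
have [[G2 _ _] [Y2 _ _]] := (GS, YS).
have [_ Qa_dom _] := Qdecomp.
have [mq q0 _] := qP.
have exactU : exact_evalue act epsU.
  exact: (exact_evalue_of_orbits G2 haarP Y2 act_cont).
split=> //; split=> //.
  by case: exactU => ev ex; split=> // P /ex ->.
move=> eps [[meps eps0] eps_valid] _ defU def.
have mU (e : borel Y -> \bar R) : measurable_fun setT e ->
    (forall y, 0 <= e y) -> measurable_fun setT (U \o e).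
  exact: nondecreasing_ge0_measurable_comp.
have QaposE (e : borel Y -> \bar R) : measurable_fun setT e ->
    (forall y, 0 <= e y) -> \int[Qa]_y (U \o e)^\+ y =
    \int[Qbar]_y maxe (q y * U (e y)) 0.
  move=> me e0; rewrite (integral_density Qa_dom qP)//; last first.
    by apply: measurable_funepos; exact: mU.
  by apply: eq_integral => y _; rewrite funeposE ge0_mule_max0.
have QanegE (e : borel Y -> \bar R) : measurable_fun setT e ->
    (forall y, 0 <= e y) -> \int[Qa]_y (U \o e)^\- y =
    \int[Qbar]_y maxe (- (q y * U (e y))) 0.
  move=> me e0; rewrite (integral_density Qa_dom qP)//; last first.
    by apply: measurable_funeneg; exact: mU.
  by apply: eq_integral => y _; rewrite funenegE ge0_mule_max0// muleN.
have mpos (e : borel Y -> \bar R) : measurable_fun setT e ->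
    (forall y, 0 <= e y) ->
    measurable_fun setT (fun y => maxe (q y * U (e y)) 0).
  move=> me e0; apply: measurable_maxe => //.
  by apply: emeasurable_funM => //; exact: mU.
have mneg (e : borel Y -> \bar R) : measurable_fun setT e ->
    (forall y, 0 <= e y) ->
    measurable_fun setT (fun y => maxe (- (q y * U (e y))) 0).
  move=> me e0; apply: measurable_maxe => //.
  apply: measurableT_comp => //.
  by apply: emeasurable_funM => //; exact: mU.
have max0 (x : \bar R) : 0 <= maxe x 0 by rewrite le_max lexx orbT.
(* The global comparison in additive form; [integral_defined] allows the
   differences to be recovered from it. *)
rewrite !(integralE _ _ (fun y => U _)).
apply: lee_sub_of_add => //; try exact: integral_ge0.
rewrite -/(U \o eps) -/(U \o epsU) !QaposE// !QanegE//.
rewrite -!ge0_integralD//; try by [exact: mpos | exact: mneg].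
apply: (integral_le_of_orbitwise G2 haarP Y2 act_cont
  (group_average_invariant G2 haarP Y2 act_cont QbarP)).
- by apply: emeasurable_funD; [exact: mpos | exact: mneg].
- by move=> y; rewrite adde_ge0.
- by apply: emeasurable_funD; [exact: mpos | exact: mneg].
- by move=> y; rewrite adde_ge0.
move=> y0; set O := act_orbit act y0.
have Oorb : is_orbit act O by exists y0.
have [l l0 argmax] := epsU_argmax _ Oorb.
have validO := eps_valid _ (unif_orbit_invariant G2 haarP Y2 act_cont O).
have exactO := epsU_exact _ Oorb.
rewrite (unif_orbit_probabilityE _ G2 Y2 act_cont) in argmax exactO *.
apply: (integral_tradeoff l0 (x := epsU) (y := eps)) => //; try exact: mU.
apply: filterS argmax => y [_ maxy] fx fy.
have := maxy _ (eps0 y); rewrite /objective.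
have -> : (eps y == +oo) = false by apply/eqP => E; rewrite E in fy.
by have -> : (epsU y == +oo) = false by apply/eqP => E; rewrite E in fx.
Qed.
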